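(* Let $L\subseteq\mathbb Z^r$ be a positive lattice and let $\mathbf u\in L\setminus\{\mathbf 0\}$. Then $\mathbf u$ is a neighbor of the origin if and only if there is no $\mathbf b\in L\setminus\{\mathbf 0,\mathbf u\}$ such that $\mathbf b\le\mathbf u^+$.
   Context: A lattice is a subgroup $L\subseteq\mathbb Z^r$; it is positive if $L\cap\mathbb N^r=\{\mathbf 0\}$, where $\mathbb N$ includes $0$. For $\mathbf u\in\mathbb Z^r$, $\mathbf u^+$ is the vector with coordinates $(\mathbf u^+)_i=\max\{u_i,0\}$. For $\mathbf a,\mathbf b\in\mathbb Z^r$, $\mathbf a\le\mathbf b$ means $(\mathbf a)_i\le(\mathbf b)_i$ for every $i$. For a nonempty finite subset $J\subseteq L$, $\max(J)\in\mathbb Z^r$ denotes the coordinatewise maximum of the elements of $J$. Let $\Delta_L$ be the collection of finite subsets $J\subseteq L$ such that $\max(J)\ne\max(J')$ for every finite subset $J'\subseteq L$ with $J'\neq J$. Let $\Delta_L^0=\{J\subseteq L\setminus\{\mathbf 0\}: J\cup\{\mathbf 0\}\in\Delta_L\}$. The vertices of $\Delta_L^0$, i.e. the vectors $\mathbf u\in L\setminus\{\mathbf 0\}$ with $\{\mathbf 0,\mathbf u\}\in\Delta_L$, are called the neighbors of the origin. *)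

(* Defs.v *)
From mathcomp Require Export all_boot all_order all_algebra.
From mathcomp Require Export finmap.
From mathcomp Require Export boolp classical_sets.

Set Implicit Arguments.
Unset Strict Implicit.
Unset Printing Implicit Defensive.

Import Order.TTheory GRing.Theory Num.Theory.

Local Open Scope classical_set_scope.
Local Open Scope ring_scope.

Section Lattices.
Variable r : nat.
Implicit Types (a b u : 'rV[int]_r) (L : set 'rV[int]_r)
  (J : {fset 'rV[int]_r}).

Definition is_lattice L : Prop := zmod_closed (mem L).

Definition lev a b : Prop := forall i, a 0 i <= b 0 i.

Definition positive_lattice L : Prop :=
  is_lattice L /\ L `&` [set a | lev 0 a] = [set 0].

Definition pos_part u : 'rV[int]_r := \row_i Num.max (u 0 i) 0.

(* The fold starts from an arbitrary element of J, because int has no least    *)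
(* element; the value at J = fset0 is meaningless and is never used.           *)
Definition vmax J : 'rV[int]_r :=
  \row_i \big[Num.max/(head 0 (enum_fset J)) 0 i]_(a <- enum_fset J) a 0 i.

Lemma vmax_ge J a : a \in J -> lev a (vmax J).
Proof. by move=> aJ i; rewrite mxE; apply: (le_bigmax_seq _ a). Qed.

Lemma vmax_attained J i :
  J != fset0%fset -> exists2 a, a \in J & vmax J 0 i = a 0 i.
Proof.
move=> J0; have hJ : head 0 (enum_fset J) \in J.
  have [x] : exists x, x \in J by apply/fset0Pn.
  have mem_hd (s : seq 'rV[int]_r) : x \in s -> head 0 s \in s.
    by case: s => //= y s _; rewrite mem_head.
  exact: mem_hd.
rewrite mxE big_seq; elim/big_ind: _ => [|x y [a aJ ->] [b bJ ->]|a aJ].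
- by exists (head 0 (enum_fset J)).
- by case: (leP (a 0 i) (b 0 i)) => _; [exists b | exists a].
- by exists a.
Qed.

(* Only nonempty sets have a maximum, so both J and J' range over nonempty     *)
(* finite subsets.                                                             *)
Definition Delta L : set {fset 'rV[int]_r} :=
  [set J | [/\ J != fset0%fset, [set` J] `<=` L &
    forall J', J' != fset0%fset -> [set` J'] `<=` L -> J' <> J ->
      vmax J <> vmax J']].

Definition Delta0 L : set {fset 'rV[int]_r} :=
  [set J | [set` J] `<=` L `\ 0 /\ Delta L (0 |` J)%fset].

Definition neighbor L u : Prop := Delta0 L [fset u]%fset.

End Lattices.

(* Main.v *)
Require Import Defs.
Import Order.TTheory GRing.Theory Num.Theory.
Local Open Scope classical_set_scope.
Local Open Scope ring_scope.

(** Since [max {0, u} = u^+], a lattice vector [b <= u^+] outside [{0, u}] can be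
    added to [{0, u}] without changing the maximum. Conversely, if there is no
    such [b], a set with maximum [u^+] is contained in [{0, u}]; being different
    from it, it is [{0}] or [{u}], so that [u <= 0] or [u >= 0], and positivity
    of [L] forces [u = 0]. *)

Lemma lev_anti {r : nat} (a b : 'rV[int]_r) : lev a b -> lev b a -> a = b.
Proof. by move=> ab ba; apply/rowP => i; apply/le_anti; rewrite ab ba. Qed.

Lemma lev_pos_part {r : nat} (u : 'rV[int]_r) : lev u (pos_part u).
Proof. by move=> i; rewrite mxE le_max lexx. Qed.

Lemma pos_part_ge0 {r : nat} (u : 'rV[int]_r) : lev 0 (pos_part u).
Proof. by move=> i; rewrite !mxE le_max lexx orbT. Qed.

Lemma pos_part_le {r : nat} (u v : 'rV[int]_r) :
  lev 0 v -> lev u v -> lev (pos_part u) v.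
Proof. by move=> v0 uv i; have := v0 i; rewrite !mxE ge_max uv => ->. Qed.

Lemma vmax_le {r : nat} (J : {fset 'rV[int]_r}) (v : 'rV[int]_r) :
  J != fset0%fset -> (forall a, a \in J -> lev a v) -> lev (vmax J) v.
Proof. by move=> J0 Jv i; have [a /Jv av ->] := vmax_attained i J0. Qed.

(** The members [0] and [u] push the maximum up to [pos_part u], and the bound on [J] keeps it from
    going further. A general [J] is allowed so that the lemma covers both [{0, u}] and its
    enlargement by [b]. *)
Lemma vmax_eq_pos_part {r : nat} (J : {fset 'rV[int]_r}) (u : 'rV[int]_r) :
  0 \in J -> u \in J -> (forall a, a \in J -> lev a (pos_part u)) ->
  vmax J = pos_part u.
Proof.
move=> J0 Ju Jle; apply: lev_anti.
  by apply: vmax_le Jle; apply/fset0Pn; exists 0.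
by apply: pos_part_le; apply: vmax_ge.
Qed.

Lemma vmax_fset1 {r : nat} (v : 'rV[int]_r) : vmax [fset v]%fset = v.
Proof.
apply: lev_anti; last by apply: vmax_ge; rewrite inE.
apply: vmax_le => [|a]; first by apply/fset0Pn; exists v; rewrite inE.
by rewrite inE => /eqP ->.
Qed.

Lemma vmax_fset0u {r : nat} (u : 'rV[int]_r) :
  vmax [fset 0; u]%fset = pos_part u.
Proof.
apply: vmax_eq_pos_part => [||a]; rewrite ?inE ?eqxx ?orbT //.
by case/orP=> /eqP ->; [apply: pos_part_ge0 | apply: lev_pos_part].
Qed.

Lemma lattice0 {r : nat} (L : set 'rV[int]_r) : is_lattice L -> L 0.
Proof. by case; rewrite inE. Qed.

Lemma latticeN {r : nat} (L : set 'rV[int]_r) (u : 'rV[int]_r) :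
  is_lattice L -> L u -> L (- u).
Proof.
case=> L0 LB Lu; rewrite -sub0r -in_setE.
by apply: LB => //; apply/mem_set.
Qed.

Lemma positive_lattice_ge0 {r : nat} (L : set 'rV[int]_r) (u : 'rV[int]_r) :
  positive_lattice L -> L u -> lev 0 u -> u = 0.
Proof.
by case=> _ Lpos Lu u0; have : (L `&` [set a | lev 0 a]) u by []; rewrite Lpos.
Qed.

(** Since [L] is a group, [- u] is a nonnegative element of [L], hence zero. *)
Lemma positive_lattice_le0 {r : nat} (L : set 'rV[int]_r) (u : 'rV[int]_r) :
  positive_lattice L -> L u -> lev u 0 -> u = 0.
Proof.
move=> Lpos Lu u0; apply/eqP; rewrite -oppr_eq0; apply/eqP.
apply: (positive_lattice_ge0 _ _ Lpos); first by apply: latticeN => //; case: Lpos.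
by move=> i; have := u0 i; rewrite !mxE oppr_ge0.
Qed.

Lemma fsubset2P {K : choiceType} (x y : K) (J : {fset K}) :
  J != fset0%fset -> (J `<=` [fset x; y])%fset ->
  [\/ J = [fset x]%fset, J = [fset y]%fset | J = [fset x; y]%fset].
Proof.
move=> J0 /fsubsetP JS.
have Jxy a : a \in J -> a = x \/ a = y.
  by move/JS; rewrite !inE => /orP[]/eqP; [left | right].
have [z zJ] := fset0Pn _ J0.
have [xJ|xJ] := boolP (x \in J); have [yJ|yJ] := boolP (y \in J).
- constructor 3; apply/fsetP => a; apply/idP/idP; first exact: JS.
  by rewrite !inE => /orP[]/eqP ->.
- constructor 1; apply/fsetP => a; rewrite inE; apply/idP/eqP => [aJ|->] //.
  by case: (Jxy a aJ) => // ay; rewrite -ay aJ in yJ.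
- constructor 2; apply/fsetP => a; rewrite inE; apply/idP/eqP => [aJ|->] //.
  by case: (Jxy a aJ) => // ax; rewrite -ax aJ in xJ.
(* With neither [x] nor [y] in [J], the element [z] has nowhere to lie. *)
- by case: (Jxy z zJ) => zE; move: xJ yJ; rewrite -zE zJ.
Qed.

Theorem lemma2p1 (r : nat) (L : set 'rV[int]_r) (u : 'rV[int]_r)
  (Lpos : positive_lattice L) (Lu : (L `\ 0) u) :
  neighbor L u <-> ~ (exists b, (L `\` [set 0; u]) b /\ lev b (pos_part u)).
Proof.
have [Lu1 /= u0] := Lu; have L0 : L 0 by case: Lpos => /lattice0.
split=> [[_ [_ _ maxU]] [b [[Lb /= b0u] bu]]|nob].
(* The competitor [{b, 0, u}] differs from [{0, u}] by its element [b], yet has the same maximum. *)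
- apply: (maxU (b |` [fset 0; u])%fset).
  + by apply/fset0Pn; exists b; rewrite !inE eqxx.
  + by move=> a /=; rewrite !inE => /or3P[]/eqP ->.
  + move=> E; have : b \in [fset 0; u]%fset by rewrite -E !inE eqxx.
    by rewrite !inE => /orP[]/eqP bE; apply: b0u; [left | right].
  + rewrite vmax_fset0u; symmetry; apply: vmax_eq_pos_part => [||a];
      rewrite ?inE ?eqxx ?orbT //.
    case/or3P=> /eqP -> //.
      exact: pos_part_ge0.
    exact: lev_pos_part.
- split; first by move=> a /=; rewrite inE => /eqP ->.
  split.
  + by apply/fset0Pn; exists 0; rewrite !inE eqxx.
  + by move=> a /=; rewrite !inE => /orP[]/eqP ->.
  + move=> J J0 JL JN; rewrite vmax_fset0u => maxJ.
    (* An element [a] of [J] outside [{0, u}] satisfies [a <= max J = u^+], so it is a vector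
       excluded by [nob]. *)
    have JS : (J `<=` [fset 0; u])%fset.
      apply/fsubsetP => a aJ; apply/negPn/negP => aN; apply: nob; exists a.
      split; last by rewrite maxJ; apply: vmax_ge.
      split; first exact: JL.
      by move=> /= aE; move: aN; case: aE => ->; rewrite !inE eqxx ?orbT.
    (* The case [J = {0, u}] contradicts [JN]. For [J = {0}] the equality of maxima reads [u^+ = 0],
       and for [J = {u}] it reads [u^+ = u]. *)
    have [JE|JE|//] := fsubset2P _ _ _ J0 JS;
      move: maxJ; rewrite JE vmax_fset1 => uE; apply: u0.
    * by apply: (positive_lattice_le0 _ _ Lpos) => //; rewrite -uE;
        apply: lev_pos_part.
    * by apply: (positive_lattice_ge0 _ _ Lpos) => //; rewrite -uE;
        apply: pos_part_ge0.
Qed.
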